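(* There is an absolute constant $C$ such that for every integer $m\ge 2$, with $p=2^m-1$, and every $k\in\mathbb{Z}_p$, the Pollard Rho walk with parameter $k$ on the cycle $\mathbb{Z}_p$ has mixing time in separation distance satisfying $$\tau_s(1/2)\le C\,\log p\,\log\log p .$$
   Context: The Pollard Rho walk with parameter $k$ on $\mathbb{Z}_p$ ($p$ odd) is the Markov chain which at each step moves from $i$ to $i+1$, to $i+k$, or to $2i$ (all modulo $p$), each with probability $1/3$ (probabilities of coinciding targets are added). Its stationary distribution $\pi$ is uniform on $\mathbb{Z}_p$. For a Markov chain with transition matrix $P$ on a finite state space $V$ and stationary distribution $\pi$, the mixing time in separation distance is $$\tau_s(\epsilon)=\min\Bigl\{n:\ \forall x,y\in V,\ 1-\frac{P^n(x,y)}{\pi(y)}\le\epsilon\Bigr\}.$$ Logarithms are natural. *)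

(* Defs.v *)
From HB Require Import structures.
From mathcomp Require Import all_boot all_order all_algebra.
From mathcomp Require Import classical_sets reals ereal exp.

Set Implicit Arguments.
Unset Strict Implicit.
Unset Printing Implicit Defensive.

Import Order.TTheory GRing.Theory Num.Theory.

Local Open Scope classical_set_scope.
Local Open Scope ring_scope.

(* A Markov chain on the state space 'I_N.+1 is given by its transition matrix
   P, with P x y the probability of a step from x to y. *)

Definition stochastic (R : realType) (N : nat) (P : 'M[R]_N.+1) : Prop :=
  (forall x y, 0 <= P x y) /\ (forall x, \sum_y P x y = 1).

Definition stationary (R : realType) (N : nat) (P : 'M[R]_N.+1)
    (pi : 'rV[R]_N.+1) : Prop :=
  [/\ forall y, 0 <= pi 0 y, \sum_y pi 0 y = 1 & pi *m P = pi].

Definition separated_within (R : realType) (N : nat) (P : 'M[R]_N.+1)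
    (pi : 'rV[R]_N.+1) (eps : R) (n : nat) : Prop :=
  forall x y : 'I_N.+1, 1 - (P ^+ n) x y / pi 0 y <= eps.

(* The infimum is over a set of natural numbers: it is a minimum when the set
   is nonempty (sep_mixing_time_min) and +oo when it is empty. *)
Definition sep_mixing_time (R : realType) (N : nat) (P : 'M[R]_N.+1)
    (pi : 'rV[R]_N.+1) (eps : R) : \bar R :=
  ereal_inf [set (n%:R)%:E | n in [set n | separated_within P pi eps n]].

(* 'Z_p is 'I_(Zp_trunc p).+2, which is the ring of integers mod p for p > 1.
   The coefficients b%:R count the targets equal to j, so that probabilities of
   coinciding targets add up. *)
Definition pollard_rho (R : realType) (p : nat) (k : 'Z_p) :
    'M[R]_((Zp_trunc p).+2) :=
  \matrix_(i, j)
    (((j == i + 1)%:R + (j == i + k)%:R + (j == 2%:R * i)%:R) / 3%:R).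

Definition uniform_dist (R : realType) (N : nat) : 'rV[R]_N.+1 :=
  const_mx (N.+1%:R^-1).

Lemma sep_mixing_time_min (R : realType) (N : nat) (P : 'M[R]_N.+1)
    (pi : 'rV[R]_N.+1) (eps : R) (n : nat) :
  separated_within P pi eps n ->
  (forall n', separated_within P pi eps n' -> (n <= n')%N) ->
  sep_mixing_time P pi eps = (n%:R)%:E.
Proof.
move=> Pn minn; apply/eqP; rewrite eq_le; apply/andP; split.
  by apply: ereal_inf_lbound; exists n.
apply: le_ereal_inf_tmp => _ [n' Pn' <-].
by rewrite lee_fin ler_nat minn.
Qed.

Lemma sum_pred1 (R : realType) (T : finType) (a : T) :
  \sum_(y : T) (y == a)%:R = 1 :> R.
Proof.
by rewrite (bigD1 a) //= eqxx big1 ?addr0 // => y /negPf ->.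
Qed.

Lemma pollard_rho_stochastic (R : realType) (p : nat) (k : 'Z_p) :
  stochastic (pollard_rho R k).
Proof.
split=> [x y|x]; first by rewrite mxE divr_ge0 ?ler0n.
under eq_bigr do rewrite mxE.
rewrite -mulr_suml.
rewrite !big_split /= !sum_pred1.
by rewrite -addrA -[1 + (1 + 1)]/(3%:R) divff ?pnatr_eq0.
Qed.

Lemma sum_preim (R : realType) (T : finType) (f : T -> T) (y : T) :
  injective f -> \sum_(x : T) (y == f x)%:R = 1 :> R.
Proof.
move=> f_inj; rewrite -[RHS](sum_pred1 R (invF f_inj y)); apply: eq_bigr => x _.
by rewrite -[in RHS](inj_eq f_inj) f_invF eq_sym.
Qed.

Lemma pollard_rho_stationary (R : realType) (p : nat) (k : 'Z_p) :
  (1 < p)%N -> odd p ->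
  stationary (pollard_rho R k) (uniform_dist R (Zp_trunc p).+1).
Proof.
move=> p_gt1 p_odd.
have N0 : ((Zp_trunc p).+2%:R : R) != 0 by rewrite pnatr_eq0.
split=> [y||]; first by rewrite mxE invr_ge0 ler0n.
  under eq_bigr do rewrite mxE.
  by rewrite sumr_const card_ord -[LHS]mulr_natr mulVf.
apply/rowP => y; rewrite !mxE.
under eq_bigr do rewrite !mxE.
rewrite -mulr_sumr -mulr_suml.
rewrite !big_split /= (sum_preim R y (addIr (1 : 'Z_p))).
have dbl_inj : injective (fun x : 'Z_p => 2%:R * x).
  by apply: mulrI; rewrite unitZpE // coprimen2.
rewrite (sum_preim R y (addIr k)) (sum_preim R y dbl_inj).
by rewrite -addrA -[1 + (1 + 1)]/(3%:R) divff ?mulr1 ?pnatr_eq0.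
Qed.

(* Main.v *)
Require Import Defs.
From HB Require Import structures.
From mathcomp Require Import all_boot all_order all_algebra.
From mathcomp Require Import classical_sets reals ereal sequences exp.
(* Re-imported so that the set lemmas of finset are not shadowed by those of classical_sets. *)
From mathcomp Require Import fintype finset.
From mathcomp Require Import ring lra zify.

Import Order.TTheory GRing.Theory Num.Theory.

Local Open Scope ring_scope.

(** Group the steps into consecutive pairs. The pairs (+1, double) and
(double, +1) are equally likely and send z to 2z + 2 and 2z + 1, so, given that
one of them occurs, it contributes a fair bit times 2^e to the final position,
where e is the number of doublings performed afterwards. Since 2^m = 1 modulo
p, only e mod m matters. If every residue e mod m receives such a bit, then,
conditionally on everything else, the final position is a constant plus
sum_e eps_e 2^e with independent fair bits eps_e; by binary expansion every
point then has probability at least 2^-m. Read from the last pair to the first,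
e is a walk on Z/m that moves by 0, 1 or 2, and a supermartingale shows that a
given residue is missed by N pairs with probability at most
(3/2) (1 - 1/(9m))^N. A union bound over the m residues gives N = O(m log m). *)

(** * The supermartingale weight on [Z/m], where [m] is [n.+2] *)

(* [z] is the distance, in units of doublings, from the current exponent to the
   residue to be hit. The jump at 0 makes up for the double step that skips the
   residue from distance 1. *)
Definition hitting_weight (R : realFieldType) (n : nat) (z : 'I_n.+2) : R :=
  if z == 0 then 1 else 5%:R / 4%:R + z%:R / (4 * n.+2)%:R.

Lemma ord_gt0 (n : nat) (z : 'I_n.+2) : (0 < z)%N = (z != 0).
Proof. by rewrite lt0n. Qed.

Lemma val_sub1_ord (n : nat) (z : 'I_n.+2) :
  (z - 1 : 'I_n.+2) = (if z == 0 then n.+1 else z.-1) :> nat.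
Proof.
case: eqP => [->|/eqP z0]; first by rewrite sub0r /= !modn_small // subn1.
have z_gt0 : (0 < z)%N by rewrite ord_gt0.
have -> : z - 1 = (z.-1)%:R :> 'Z_n.+2.
  by rewrite -[z in LHS]natr_Zp -[in LHS](prednK z_gt0) -[z.-1.+1]addn1 natrD addrK.
apply: etrans (val_Zp_nat (isT : (1 < n.+2)%N) _) _.
by rewrite modn_small //; apply: leq_ltn_trans (leq_pred _) (ltn_ord z).
Qed.

Lemma hitting_weight_ge1 (R : realFieldType) (n : nat) (z : 'I_n.+2) :
  1 <= hitting_weight R n z.
Proof.
rewrite /hitting_weight; case: eqP => // _.
have : 0 <= z%:R / (4 * n.+2)%:R :> R by rewrite divr_ge0 ?ler0n.
move: (_ / (_ * _)%:R) => w; lra.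
Qed.

Lemma hitting_weight_le (R : realFieldType) (n : nat) (z : 'I_n.+2) :
  hitting_weight R n z <= 3%:R / 2%:R.
Proof.
rewrite /hitting_weight; case: eqP => [_|_]; first by lra.
have : z%:R / (4 * n.+2)%:R <= 4%:R^-1 :> R.
  rewrite ler_pdivrMr ?ltr0n ?muln_gt0 // mulrC ler_pdivlMr ?ltr0n //.
  by rewrite -natrM ler_nat mulnC leq_mul2l /= ltnW.
move: (_ / (_ * _)%:R) => w; lra.
Qed.

(* Of the 9 equally likely pairs, 4 contain no doubling, 4 contain one, and 1
   contains two; two of those with one doubling hit the residue when [z = 0]. *)
Lemma hitting_weight_drift (R : realFieldType) (n : nat) (z : 'I_n.+2) :
  4%:R * hitting_weight R n z + 2%:R * hitting_weight R n (z - 1)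
    + (if z == 0 then 0 else 2%:R * hitting_weight R n (z - 1))
    + hitting_weight R n (z - 1 - 1)
  <= 9%:R * ((1 - (9 * n.+2)%:R^-1) * hitting_weight R n z).
Proof.
have mE : (9 * n.+2)%:R^-1 = (n.+2%:R)^-1 / 9%:R :> R.
  by rewrite natrM invfM mulrC.
have m4E w : w / (4 * n.+2)%:R = w * (n.+2%:R)^-1 / 4%:R :> R.
  by rewrite natrM invfM mulrA mulrAC.
have m_gt0 : 0 < (n.+2%:R)^-1 :> R by rewrite invr_gt0 ltr0n.
have m_le : (n.+2%:R)^-1 <= 2%:R^-1 :> R.
  by rewrite lef_pV2 ?posrE ?ltr0n // ler_nat.
have z_le : z%:R * (n.+2%:R)^-1 <= 1 :> R.
  by rewrite ler_pdivrMr ?ltr0n // mul1r ler_nat ltnW.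
have z_ge : 0 <= z%:R * (n.+2%:R)^-1 :> R by rewrite mulr_ge0 ?ler0n // ltW.
move: (n.+2%:R^-1) mE m4E m_gt0 m_le z_le z_ge => i mE m4E m_gt0 m_le z_le z_ge.
have h1_le := hitting_weight_le R n (z - 1).
have h2_le := hitting_weight_le R n (z - 1 - 1).
(* At [z = 0] the bound 3/2 on the other weights gives 4 + 3 + 3/2 = 17/2, which is at most 9 - 1/m
   as m >= 2. *)
have [z0|z_neq0] := eqVneq z 0.
  rewrite mE {1 4}/hitting_weight z0 eqxx -z0.
  nra.
have z_gt0 : (0 < z)%N by rewrite ord_gt0.
have z1E : (z - 1 : 'I_n.+2) = z.-1 :> nat by rewrite val_sub1_ord (negPf z_neq0).
have [z1|z1_neq0] := eqVneq (z - 1) 0.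
  have zE : z = 1%N :> nat by move: z1E; rewrite z1 /=; lia.
  rewrite mE {2 3}/hitting_weight z1 eqxx -z1.
  rewrite {1 3}/hitting_weight (negPf z_neq0) !m4E.
  rewrite !zE in z_le z_ge *.
  nra.
have z1_gt0 : (0 < (z - 1)%R)%N by rewrite ord_gt0.
have z2E : (z - 1 - 1 : 'I_n.+2) = z.-2 :> nat.
  by rewrite val_sub1_ord (negPf z1_neq0) z1E.
(* The affine formula also bounds the weight 1 at 0. With w the weight at [z], the left side is then
   at most 9w - 3/(2m), and w <= 3/2 concludes. *)
have h2 : hitting_weight R n (z - 1 - 1)
    <= 5%:R / 4%:R + (z%:R - 2%:R) * i / 4%:R.
  rewrite /hitting_weight z2E m4E; case: eqP => [_|_].
    have : 0 <= (z%:R - 2%:R) * i.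
      by rewrite mulr_ge0 ?(ltW m_gt0) // subr_ge0 ler_nat; move: z1_gt0; rewrite z1E; lia.
    lra.
  rewrite -natrB; last by move: z1_gt0; rewrite z1E; lia.
  by rewrite subn2.
have hz : hitting_weight R n z = 5%:R / 4%:R + z%:R * i / 4%:R.
  by rewrite /hitting_weight (negPf z_neq0) m4E.
have hz1 : hitting_weight R n (z - 1) = 5%:R / 4%:R + (z%:R - 1) * i / 4%:R.
  by rewrite /hitting_weight (negPf z1_neq0) m4E z1E -subn1 natrB.
rewrite mE hz hz1.
nra.
Qed.

(** * Binary expansions and subset sums of powers of 2 *)

Lemma sum_bits (n m : nat) :
  (\sum_(i < m) odd (n %/ 2 ^ i) * 2 ^ i = n %% 2 ^ m)%N.
Proof.
elim: m => [|m IHm]; first by rewrite big_ord0 modn1.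
rewrite big_ord_recr /= IHm expnS mulnC.
have d_gt0 : (0 < 2 ^ m)%N by rewrite expn_gt0.
have nE : n = ((n %/ 2 ^ m)./2 * (2 * 2 ^ m) + (odd (n %/ 2 ^ m) * 2 ^ m + n %% 2 ^ m))%N.
  rewrite {1}(divn_eq n (2 ^ m)) -[in LHS](odd_double_half (n %/ 2 ^ m)).
  by rewrite -mul2n; lia.
rewrite [in RHS]nE modnMDl [RHS]modn_small; first by rewrite addnC mulnC.
have := ltn_pmod n d_gt0.
case: odd; lia.
Qed.

Lemma powerset_setU1 (V : nmodType) (T : finType) (a : T) (A : {set T}) (F : {set T} -> V) :
  a \notin A ->
  \sum_(B in powerset (a |: A)) F B =
  \sum_(B in powerset A) (F B + F (a |: B)).
Proof.
move=> aA.
rewrite (bigID (fun B : {set T} => a \in B)) /= addrC big_split /=; congr (_ + _).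
  apply: eq_bigl => B; rewrite !powersetE.
  apply/andP/idP => [[sB aB]|sB].
    by rewrite -(setU1K aA) subsetD1 sB.
  split; first by rewrite (subset_trans sB) ?subsetUr.
  by apply: contra aA; apply: (subsetP sB).
rewrite (reindex_onto (fun B => a |: B) (fun B => B :\ a)) /=; last first.
  by move=> B /andP[_ aB]; rewrite setD1K.
apply: eq_bigl => B; rewrite !powersetE setU11 andbT.
apply/andP/idP => [[sB /eqP eB]|sB].
  by rewrite -(setU1K aA) -eB setSD.
by rewrite setUS // setU1K //; apply: contra aA; apply: (subsetP sB).
Qed.

(** Exponents are taken in [Z/m], so that once 2^m = 1 a negative exponent expresses halving modulo
    [p]. *)
Definition pow2 (n p : nat) (e : 'I_n.+2) : 'Z_p := 2%:R ^+ e.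

Lemma pow2D (n p : nat) (e f : 'I_n.+2) :
  2%:R ^+ n.+2 = 1 :> 'Z_p -> pow2 n p (e + f) = pow2 n p e * pow2 n p f.
Proof. by move=> two_m; rewrite /pow2 /= (expr_mod _ two_m) exprD. Qed.

Lemma pow2_1 (n p : nat) : pow2 n p 1 = 2%:R.
Proof. by rewrite /pow2 /= modn_small. Qed.

Lemma pow2VK (n p : nat) (e : 'I_n.+2) :
  2%:R ^+ n.+2 = 1 :> 'Z_p -> pow2 n p (- e) * pow2 n p e = 1.
Proof. by move=> two_m; rewrite -pow2D // addNr. Qed.

Lemma pow2_onto (n p : nat) (z : 'Z_p) : (1 < p)%N -> (p <= 2 ^ n.+2)%N ->
  exists B : {set 'I_n.+2}, \sum_(r in B) pow2 n p r = z.
Proof.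
move=> p_gt1 p_le.
exists [set r : 'I_n.+2 | odd (z %/ 2 ^ r)].
have z_lt : (z < 2 ^ n.+2)%N.
  by apply: leq_trans p_le; rewrite -[p in (_ < p)%N]Zp_cast //.
rewrite -[RHS]natr_Zp -{2}(modn_small z_lt) -sum_bits natr_sum big_mkcond /=.
by apply: eq_bigr => r _; rewrite inE natrM natrX /pow2; case: odd; rewrite ?mul1r ?mul0r.
Qed.

(** * Averages over free bits and the last step of the walk *)

(* [2 ^ #|A|] times the mean of [F] at the point from which [e] doublings lead
   to [c - sum_(r in A) eps_r 2^r], for independent fair bits [eps_r]. *)
Definition bit_sum (R : realFieldType) (n p : nat) (F : 'Z_p -> R)
    (A : {set 'I_n.+2}) (e : 'I_n.+2) (c : 'Z_p) : R :=
  \sum_(B in powerset A) F (pow2 n p (- e) * (c - \sum_(r in B) pow2 n p r)).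

Lemma bit_sum_join (R : realFieldType) (n p : nat) (F : 'Z_p -> R)
    (A : {set 'I_n.+2}) (a e : 'I_n.+2) (c : 'Z_p) : a \notin A ->
  bit_sum R n p F (a |: A) e c =
  bit_sum R n p F A e c + bit_sum R n p F A e (c - pow2 n p a).
Proof.
move=> aA; rewrite /bit_sum powerset_setU1 // big_split /=; congr (_ + _).
apply: eq_bigr => B; rewrite powersetE => sB; rewrite big_setU1 ?opprD ?addrA //.
by apply: contra aA; apply: (subsetP sB).
Qed.

(** Before [e] doublings, a step +1 or +k shifts the target by 2^e or 2^e k, and a doubling raises
    [e] by 1. *)
Lemma bit_sum_step (R : realFieldType) (n p : nat) (k : 'Z_p) (F G : 'Z_p -> R)
    (A : {set 'I_n.+2}) (e : 'I_n.+2) (c : 'Z_p) :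
  2%:R ^+ n.+2 = 1 :> 'Z_p ->
  (forall y, G y = (F (y - 1) + F (y - k) + F (pow2 n p (- 1) * y)) / 3%:R) ->
  bit_sum R n p G A e c =
  (bit_sum R n p F A e (c - pow2 n p e) + bit_sum R n p F A e (c - pow2 n p e * k)
   + bit_sum R n p F A (e + 1) c) / 3%:R.
Proof.
move=> two_m GE; rewrite /bit_sum -!big_split /= mulr_suml.
have shift a b : pow2 n p (- e) * (c - b) - a = pow2 n p (- e) * (c - pow2 n p e * a - b).
  by rewrite -[a in LHS]mul1r -(pow2VK _ _ e two_m); ring.
apply: eq_bigr => B _; rewrite GE !shift mulr1.
by rewrite [- (e + 1)]opprD [- e - 1]addrC pow2D // -[in RHS]mulrA.
Qed.

Lemma sum_mul_pred1 (R : realFieldType) (T : finType) (F : T -> R) (f g : T -> T) (y : T) :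
  cancel f g -> cancel g f -> \sum_z F z * (y == f z)%:R = F (g y).
Proof.
move=> fK gK; rewrite (bigD1 (g y)) //= gK eqxx mulr1 big1 ?addr0 // => z /negPf zN.
by rewrite -(can_eq gK y) fK eq_sym zN mulr0.
Qed.

Lemma mul_pollard_rho (R : realType) (n p : nat) (k : 'Z_p)
    (M : 'M[R]_((Zp_trunc p).+2)) (x y : 'Z_p) :
  2%:R ^+ n.+2 = 1 :> 'Z_p ->
  (M * pollard_rho R k) x y =
  (M x (y - 1) + M x (y - k) + M x (pow2 n p (- 1) * y)) / 3%:R.
Proof.
move=> two_m; rewrite !mxE.
under eq_bigr do rewrite mxE mulrA !mulrDr.
have twoV := pow2VK _ _ 1 two_m.
rewrite -mulr_suml !big_split /=.
rewrite (sum_mul_pred1 _ _ _ _ (fun z : 'Z_p => z - 1)); [|exact: addrK|exact: subrK].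
rewrite (sum_mul_pred1 _ _ _ _ (fun z : 'Z_p => z - k)); [|exact: addrK|exact: subrK].
rewrite pow2_1 in twoV.
rewrite (sum_mul_pred1 _ _ _ _ (fun z : 'Z_p => pow2 n p (- 1) * z)) //.
  by move=> z; rewrite mulrA twoV mul1r.
by move=> z; rewrite mulrA [2%:R * _]mulrC twoV mul1r.
Qed.

(** Sum of [hitting_weight_drift] over uncovered [r], at [z = r - e]: the term dropped at [z = 0] is
    that of [e], newly covered. *)
Lemma uncovered_drift (R : realFieldType) (n : nat) (A : {set 'I_n.+2}) (e : 'I_n.+2) :
  4%:R * (\sum_(r in ~: A) hitting_weight R n (r - e))
    + 2%:R * (\sum_(r in ~: A) hitting_weight R n (r - (e + 1)))
    + 2%:R * (\sum_(r in ~: (e |: A)) hitting_weight R n (r - (e + 1)))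
    + \sum_(r in ~: A) hitting_weight R n (r - (e + 1 + 1))
  <= 9%:R * ((1 - (9 * n.+2)%:R^-1) * \sum_(r in ~: A) hitting_weight R n (r - e)).
Proof.
have -> : \sum_(r in ~: (e |: A)) hitting_weight R n (r - (e + 1)) =
    \sum_(r in ~: A) (if r - e == 0 then 0 else hitting_weight R n (r - (e + 1))).
  rewrite [RHS]big_mkcond [LHS]big_mkcond; apply: eq_bigr => r _.
  by rewrite !inE subr_eq0; case: eqP; case: (r \in A).
rewrite !mulr_sumr -!big_split /=; apply: ler_sum => r _.
have := hitting_weight_drift R n (r - e).
rewrite !opprD !addrA; by case: eqP => //=; rewrite mulr0.
Qed.

(* Induction on [N] that peels off the last pair of steps; [A] is the set of
   exponents that the pairs already peeled off have covered. *)
Lemma bit_sum_ge (R : realType) (n p : nat) (k : 'Z_p) :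
  (1 < p)%N -> (p <= 2 ^ n.+2)%N -> 2%:R ^+ n.+2 = 1 :> 'Z_p ->
  forall (N : nat) (A : {set 'I_n.+2}) (e : 'I_n.+2) (x c : 'Z_p),
  1 - (1 - (9 * n.+2)%:R^-1) ^+ N * \sum_(r in ~: A) hitting_weight R n (r - e)
  <= 2%:R ^+ #|~: A| * bit_sum R n p ((pollard_rho R k ^+ (2 * N)) x) A e c.
Proof.
move=> p_gt1 p_le two_m; elim=> [|N IHN] A e x c /=.
  rewrite muln0 !expr0 mul1r.
  (* If all exponents are covered, a binary expansion gives a term equal to 1; otherwise a weight of
     at least 1 makes the left side nonpositive. *)
  have [->|A_neqT] := eqVneq A setT.
    rewrite setCT cards0 big_set0 subr0 mul1r /bit_sum powersetT.
    have [B BE] := pow2_onto n p (c - pow2 n p e * x) p_gt1 p_le.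
    rewrite (bigD1 B) ?inE //= BE subKr mulrA pow2VK // mul1r.
    rewrite mxE eqxx ler_wpDr // sumr_ge0 // => C _.
    by rewrite mxE ler0n.
  apply: (@le_trans _ _ 0); last first.
    apply: mulr_ge0; rewrite ?exprn_ge0 // sumr_ge0 // => B _.
    by rewrite mxE ler0n.
  have /set0Pn[r rA] : ~: A != set0.
    by apply: contra A_neqT => /eqP A0; rewrite -[A]setCK A0 setC0.
  rewrite subr_le0 (bigD1 r) //= ler_wpDr ?hitting_weight_ge1 //.
  by apply: sumr_ge0 => i _; apply: le_trans (hitting_weight_ge1 _ _ _).
set rho : R := 1 - (9 * n.+2)%:R^-1; rewrite -/rho in IHN.
have rho_ge0 : 0 <= rho ^+ N.
  by rewrite exprn_ge0 // /rho subr_ge0 invf_le1 ?ltr0n // ler1n.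
pose P := pollard_rho R k.
have step := bit_sum_step R n p k _ _ A _ _ two_m (fun y => mul_pollard_rho R n p k _ x y two_m).
rewrite mulnS addnC exprD expr2 mulrA !step.
rewrite [in c - pow2 n p (e + 1)]pow2D // pow2_1 mulr_natr mulr2n opprD addrA.
have drift := ler_wpM2l rho_ge0 (uncovered_drift R n A e); rewrite -/rho in drift.
have I := IHN _ _ x _.
(* The nine pairs: [I1] to [I4] have no doubling, [I5] and [I6] mix a doubling with +k, [I7] has two
   doublings, and [I8] treats both pairs of +1 and a doubling. *)
have I1 := I A e (c - pow2 n p e - pow2 n p e).
have I2 := I A e (c - pow2 n p e - pow2 n p e * k).
have I3 := I A e (c - pow2 n p e * k - pow2 n p e).
have I4 := I A e (c - pow2 n p e * k - pow2 n p e * k).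
have I5 := I A (e + 1) (c - pow2 n p e * k).
have I6 := I A (e + 1) (c - pow2 n p (e + 1) * k).
have I7 := I A (e + 1 + 1) c.
have I8 : 2%:R * (1 - rho ^+ N * \sum_(r in ~: (e |: A)) hitting_weight R n (r - (e + 1)))
  <= 2%:R ^+ #|~: A| * (bit_sum R n p ((P ^+ (2 * N)) x) A (e + 1) (c - pow2 n p e)
     + bit_sum R n p ((P ^+ (2 * N)) x) A (e + 1) (c - pow2 n p e - pow2 n p e)).
  have [eA|eA] := boolP (e \in A).
    have -> : e |: A = A by apply/setUidPr; rewrite sub1set.
    have J1 := I A (e + 1) (c - pow2 n p e).
    have J2 := I A (e + 1) (c - pow2 n p e - pow2 n p e).
    by rewrite (mulr_natl (1 - _) 2) mulr2n mulrDr lerD.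
  (* The two targets differ by 2^e, so they merge into a free bit at [e]; the complement of [A]
     loses one element, whence the factor 2. *)
  rewrite -bit_sum_join //.
  have -> : #|~: A| = #|~: (e |: A)|.+1.
    by rewrite setCU setIC -setDE [in LHS](cardsD1 e) inE eA.
  by rewrite exprS -mulrA ler_wpM2l // I.
move: drift I1 I2 I3 I4 I5 I6 I7 I8.
rewrite exprS -/rho -/P !mulrDr.
move: (rho ^+ N) => q.
set t1 := \sum_(r in _) _; set t2 := \sum_(r in _) _.
set t3 := \sum_(r in _) _; set t4 := \sum_(r in _) _.
lra.
Qed.

(** * Separation after 18 m s steps *)

Lemma expr_one_sub_inv_le (R : realType) (K : nat) : (0 < K)%N ->
  (1 - K%:R^-1) ^+ K <= 2%:R^-1 :> R.
Proof.
move=> K_gt0.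
have K0 : K%:R != 0 :> R by rewrite pnatr_eq0 -lt0n.
apply: (@le_trans _ _ (expR (- K%:R^-1) ^+ K)).
  rewrite lerXn2r ?nnegrE ?expR_ge0 ?expR_ge1Dx //.
  by rewrite subr_ge0 invf_le1 ?ltr0n // ler1n.
rewrite -expRM_natr mulNr mulVf // expRN lef_pV2 ?posrE ?expR_gt0 //.
by have := expR_ge1Dx (1 : R); rewrite -[1 + 1]/(2%:R).
Qed.

Lemma pollard_rho_separated (R : realType) (n s : nat) (k : 'Z_(2 ^ n.+2 - 1)) :
  (5 * n.+2 <= 2 ^ s)%N ->
  separated_within (pollard_rho R k) (uniform_dist R (Zp_trunc (2 ^ n.+2 - 1)).+1)
    (1 / 2%:R) (2 * (9 * n.+2 * s)).
Proof.
have num_le : 5%:R^-1 * (3%:R / 2%:R) <= 3%:R / 10%:R :> R by lra.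
move: k; set p := (2 ^ n.+2 - 1)%N => k s_ge x y.
have pow_ge : (4 <= 2 ^ n.+2)%N by rewrite !expnS; have := expn_gt0 2 n; lia.
have pS : p.+1 = (2 ^ n.+2)%N by rewrite /p; lia.
have p_gt1 : (1 < p)%N by rewrite /p; lia.
have p_le : (p <= 2 ^ n.+2)%N by rewrite -pS.
have two_m : 2%:R ^+ n.+2 = 1 :> 'Z_p.
  by rewrite -natrX -pS -natr1 pchar_Zp // add0r.
have := bit_sum_ge R n p k p_gt1 p_le two_m (9 * n.+2 * s) set0 0 x y.
under [\sum_(r in ~: _) _]eq_bigr do rewrite subr0.
rewrite /bit_sum powerset0 big_set1 big_set0 oppr0 subr0 /pow2 expr0 mul1r.
rewrite setC0 cardsT card_ord -natrX -pS.
set q := fun_of_matrix _ x y => q_ge.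
rewrite /uniform_dist mxE invrK Zp_cast //.
have rho_le : (1 - (9 * n.+2)%:R^-1) ^+ (9 * n.+2 * s) <= (5 * n.+2)%:R^-1 :> R.
  rewrite exprM; apply: (@le_trans _ _ (2%:R^-1 ^+ s)).
    rewrite lerXn2r ?nnegrE ?invr_ge0 ?ler0n ?expr_one_sub_inv_le //.
    by rewrite exprn_ge0 // subr_ge0 invf_le1 ?ltr0n // ler1n.
  by rewrite exprVn -natrX lef_pV2 ?posrE ?ltr0n ?expn_gt0 // ler_nat.
have sum_le : \sum_(r in [set: 'I_n.+2]) hitting_weight R n r <= n.+2%:R * (3%:R / 2%:R).
  apply: (@le_trans _ _ (\sum_(r in [set: 'I_n.+2]) (3%:R / 2%:R))).
    by apply: ler_sum => r _; apply: hitting_weight_le.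
  by rewrite sumr_const cardsT card_ord -[X in X <= _]mulr_natl.
have sum_ge0 : 0 <= \sum_(r in [set: 'I_n.+2]) hitting_weight R n r.
  by apply: sumr_ge0 => r _; apply: le_trans (hitting_weight_ge1 _ _ _).
have prod_le : (1 - (9 * n.+2)%:R^-1) ^+ (9 * n.+2 * s)
    * \sum_(r in [set: 'I_n.+2]) hitting_weight R n r <= 3%:R / 10%:R.
  apply: le_trans (ler_wpM2r sum_ge0 rho_le) _.
  apply: le_trans (ler_wpM2l _ sum_le) _; first by rewrite invr_ge0 ler0n.
  by rewrite natrM invfM -mulrA mulKf ?pnatr_eq0.
have p_ge3 : 3%:R <= p%:R :> R by rewrite ler_nat; lia.
move: prod_le q_ge; rewrite  -[p.+1%:R]natr1; set w := (_ * \sum_(r in _) _).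
move: w p%:R p_ge3 q => w P P_ge3 q w_le q_ge.
(* Here (p + 1) q >= 7/10, and p / (p + 1) >= 3/4 gives p q >= 21/40 > 1/2. *)
have q_ge0 : 0 <= q by nra.
nra.
Qed.

(** * Comparison of m with log p *)

(** Makes [ln (ln 3)] positive. It follows from exp(-1/8) > 7/8 and (8/7)^8 < 3. *)
Lemma ln3_gt1 (R : realType) : 1 < ln (3%:R : R).
Proof.
rewrite -[X in X < _](@expRK R) ltr_ln ?posrE ?expR_gt0 ?ltr0n //.
have h : 7%:R / 8%:R < expR (- 8%:R^-1) :> R.
  have := @expR_gt1Dx R (- 8%:R^-1); rewrite oppr_eq0 invr_eq0 pnatr_eq0 => /(_ isT).
  lra.
have h8 : (7%:R / 8%:R) ^+ 8 < expR (- 1) :> R.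
  have -> : - 1 = - 8%:R^-1 * 8%:R :> R by rewrite mulNr mulVf ?pnatr_eq0.
  by rewrite expRM_natr ltrXn2r //; lra.
rewrite expRN in h8.
have e_gt0 := expR_gt0 (1 : R).
rewrite -[X in X < _]invrK invf_plt ?posrE ?invr_gt0 ?ltr0n //.
apply: lt_trans h8; lra.
Qed.

Lemma exp3_le (j : nat) : (0 < j)%N -> (3 ^ j <= 2 ^ (j.*2) - 1)%N.
Proof.
elim: j => // -[|j] IHj _ //.
have := IHj isT; rewrite doubleS (expnS 3 j.+1) (expnS 2 (j.+1).*2.+1) (expnS 2 (j.+1).*2); lia.
Qed.

Theorem theorem4p2 (R : realType) :
  exists C : R, forall (m : nat), (2 <= m)%N ->
    let p := (2 ^ m - 1)%N in
    forall k : 'Z_p,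
      (sep_mixing_time (pollard_rho R k) (uniform_dist R (Zp_trunc p).+1)
         (1 / 2%:R)
       <= (C * ln (p%:R : R) * ln (ln (p%:R : R)))%:E)%E.
Proof.
have l3 := ln3_gt1 R.
have l2_gt0 : 0 < ln (2%:R : R) by rewrite ln_gt0 // ltr1n.
have ll3_gt0 : 0 < ln (ln (3%:R : R)) by rewrite ln_gt0.
(* The 18 m s steps and m <= 3 log p give 54. In s = [t + 5], the 5 is absorbed through [ln (ln 3)],
   and [ln 2] converts the base-2 logarithm [t]. *)
exists (54%:R * (5%:R / ln (ln 3%:R) + (ln 2%:R)^-1)) => -[//|[//|n]] _ /= k.
pose j := (n.+2)./2; pose t := trunc_log 2 j.
have j_gt0 : (0 < j)%N by rewrite /j; lia.
have m_le : (n.+2 <= 3 * j)%N by rewrite /j; lia.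
(* 5m <= 15j < 16 * 2^(t+1). *)
have t_ge : (5 * n.+2 <= 2 ^ (t + 5))%N.
  have := trunc_log_ltn j (isT : (1 < 2)%N); rewrite -/t expnS expnD; lia.
apply: le_trans (ereal_inf_lbound _) _.
  by exists (2 * (9 * n.+2 * (t + 5)))%N => //; apply: pollard_rho_separated.
rewrite lee_fin.
have p_ge : (3 ^ j <= 2 ^ n.+2 - 1)%N.
  apply: leq_trans (exp3_le j j_gt0) _; apply: leq_sub2r.
  by rewrite leq_exp2l // /j; lia.
have lnp_ge : j%:R * ln (3%:R : R) <= ln (2 ^ n.+2 - 1)%:R.
  rewrite mulr_natl -lnXn ?ltr0n // -natrX ler_ln ?posrE ?ltr0n ?expn_gt0 ?ler_nat //.
  by apply: leq_trans p_ge; rewrite expn_gt0.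
have j_ge1 : 1 <= j%:R :> R by rewrite ler1n.
have lnlnp_ge : ln (j%:R : R) + ln (ln (3%:R : R)) <= ln (ln (2 ^ n.+2 - 1)%:R).
  rewrite -lnM ?posrE ?ltr0n //; last by lra.
  have jl_gt0 : 0 < j%:R * ln (3%:R : R) by nra.
  by rewrite ler_ln ?posrE // (lt_le_trans jl_gt0).
have t_le : t%:R * ln (2%:R : R) <= ln j%:R.
  rewrite mulr_natl -lnXn ?ltr0n // -natrX ler_ln ?posrE ?ltr0n ?expn_gt0 // ler_nat.
  exact: trunc_logP.
have lnj_ge0 : 0 <= ln (j%:R : R) by rewrite ln_ge0.
have s_le : (t + 5)%:R <= (5%:R / ln (ln 3%:R) + (ln 2%:R)^-1)
    * ln (ln (2 ^ n.+2 - 1)%:R) :> R.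
  have K_ge0 : 0 <= 5%:R / ln (ln 3%:R) + (ln 2%:R)^-1 :> R.
    by rewrite addr_ge0 ?divr_ge0 ?invr_ge0 // ltW.
  apply: le_trans (ler_wpM2l K_ge0 lnlnp_ge).
  have t_le' : t%:R <= (ln 2%:R)^-1 * ln (j%:R : R).
    by rewrite mulrC ler_pdivlMr.
  rewrite natrD mulrDl !mulrDr -[5%:R / _ * ln (ln _)]mulrA mulVf ?gt_eqF // mulr1.
  have a1 : 0 <= 5%:R / ln (ln 3%:R) * ln (j%:R : R).
    by rewrite mulr_ge0 // divr_ge0 // ltW.
  have a2 : 0 <= (ln 2%:R)^-1 * ln (ln (3%:R : R)).
    by rewrite mulr_ge0 ?invr_ge0 // ltW.
  lra.
have m_leR : n.+2%:R <= 3%:R * ln (2 ^ n.+2 - 1)%:R :> R.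
  apply: (@le_trans _ _ (3%:R * j%:R)); first by rewrite -natrM ler_nat.
  by rewrite ler_wpM2l //; apply: le_trans lnp_ge; nra.
have -> : (2 * (9 * n.+2 * (t + 5)))%:R = 18%:R * (n.+2%:R * (t + 5)%:R) :> R.
  by rewrite !natrM; ring.
have := ler_pM (ler0n _ _) (ler0n _ _) m_leR s_le.
move: (5%:R / _ + _) (_ * (t + 5)%:R) (ln (ln (2 ^ n.+2 - 1)%:R)) => K ms LL ms_le.
move: (ln _) ms_le => L ms_le.
have -> : 54%:R * K * L * LL = 18%:R * (3%:R * L * (K * LL)) by ring.
by rewrite ler_pM2l ?ltr0n.
Qed.
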